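(* Let $A\in\mathbf{RM}_5$ be a reciprocal $5\times 5$ matrix with associated parameters $\xi_1,\xi_2,\xi_3,\xi_4\ge 0$. The Kippenhahn curve $C(A)$ contains two non-concentric (non-degenerate) ellipses if and only if $$\xi_2\xi_3=0,\quad \xi_2+\xi_3\neq 0,\quad \xi_1=\tfrac{\sqrt3}{2}(\xi_2+\xi_3)+\xi_3,\quad \xi_4=\tfrac{\sqrt3}{2}(\xi_2+\xi_3)+\xi_2 .$$ If this is the case, then $C(A)=E_1\cup E_2\cup\{0\}$, where $E_1$ is an ellipse with foci $\sqrt3,-1$, $E_2$ is an ellipse with foci $-\sqrt3, 1$, and the length of the (full) minor axis of both $E_1$ and $E_2$ equals $(1+\sqrt3)\sqrt{\xi_2+\xi_3}$.
   Context: A matrix $A=(a_{ij})\in M_n(\mathbb C)$ is reciprocal, $A\in\mathbf{RM}_n$, if it is tridiagonal with zero main diagonal ($a_{ij}=0$ whenever $|i-j|\neq1$) and $a_{i,i+1}a_{i+1,i}=1$ for $i=1,\dots,n-1$. Its parameters are $\xi_j=\frac14(|a_{j,j+1}|-|a_{j+1,j}|)^2\ge 0$, $j=1,\dots,n-1$. For $A\in M_n(\mathbb C)$ put $\operatorname{Re}A=(A+A^* )/2$, let $\lambda_1(\theta)\ge\dots\ge\lambda_n(\theta)$ be the eigenvalues (with multiplicity) of $\operatorname{Re}(e^{i\theta}A)$, and let $\ell_j(\theta)=e^{-i\theta}(\lambda_j(\theta)+i\mathbb R)$, $\theta\in[0,2\pi)$, $j=1,\dots,n$. The Kippenhahn curve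 $C(A)$ is the envelope of this family of lines. It is understood via its tangent lines: an ellipse $E$ is contained in $C(A)$ if every tangent line of $E$ belongs to the family; and $C(A)$ is the union of given ellipses and points if, for every $\theta$, the multiset of lines $\ell_1(\theta),\dots,\ell_n(\theta)$ is the multiset union of the two tangent lines parallel to $e^{-i\theta}i\mathbb R$ of each ellipse and of the line in this direction through each point. Two ellipses are non-concentric if their centers differ. Non-degenerate means that the minor axis has positive length. *)

(* Defs.v *)
From HB Require Import structures.
From mathcomp Require Import all_boot all_order all_algebra.
From mathcomp Require Import complex.
From mathcomp Require Import all_classical all_reals.
From mathcomp Require Import trigo.

Set Implicit Arguments.
Unset Strict Implicit.
Unset Printing Implicit Defensive.

Import Order.TTheory GRing.Theory Num.Theory.

Local Open Scope classical_set_scope.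
Local Open Scope ring_scope.
Local Open Scope sesquilinear_scope.
Local Open Scope complex_scope.

Definition reciprocal (R : realType) (n : nat) (A : 'M[R[i]]_n) : Prop :=
  (forall i j : 'I_n, i.+1 != j -> j.+1 != i -> A i j = 0) /\
  (forall i j : 'I_n, j = i.+1 :> nat -> A i j * A j i = 1).

(* xi A j is xi_j with the usual numbering 1 <= j <= n of the parameters of an
   (n+1) x (n+1) matrix; the rows j and j+1 of the mathematical text are the
   0-based indices j.-1 and j. *)
Definition xi (R : realType) (n : nat) (A : 'M[R[i]]_n.+1) (j : nat) : R :=
  4^-1 * (ComplexField.Normc.normc (A (inord j.-1) (inord j))
          - ComplexField.Normc.normc (A (inord j) (inord j.-1))) ^+ 2.

Definition expi (R : realType) (theta : R) : R[i] := cos theta +i* sin theta.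

Definition re_mx (R : realType) (n : nat) (A : 'M[R[i]]_n) : 'M[R[i]]_n :=
  2^-1 *: (A + A ^t*).

(* Eigenvalues with algebraic multiplicity, in nonincreasing order.  Taking
   real parts is harmless for the Hermitian matrices this is applied to. *)
Definition eigenvalues (R : realType) (n : nat) (H : 'M[R[i]]_n) : seq R :=
  sort >=%R
    [seq complex.Re z | z <- sval (closed_field_poly_normal (char_poly H))].

(* The line e^{-i theta} (lam + i R). *)
Definition line (R : realType) (theta lam : R) : set R[i] :=
  [set expi (- theta) * (lam +i* t) | t in [set: R]].

Definition ell (R : realType) (n : nat) (A : 'M[R[i]]_n) (theta : R)
    (j : 'I_n) : set R[i] :=
  line theta (nth 0 (eigenvalues (re_mx (expi theta *: A))) j).

(* Non-degenerate ellipses; circles (focus1 = focus2) are included.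
   minor_axis is the full length of the minor axis. *)
Record ellipse (R : realType) := Ellipse {
  focus1 : R[i];
  focus2 : R[i];
  minor_axis : R;
  minor_axis_gt0 : 0 < minor_axis }.

Definition center (R : realType) (E : ellipse R) : R[i] :=
  (focus1 E + focus2 E) / 2.

Definition major_axis (R : realType) (E : ellipse R) : R :=
  Num.sqrt (minor_axis E ^+ 2
            + ComplexField.Normc.normc (focus1 E - focus2 E) ^+ 2).

Definition ellipse_points (R : realType) (E : ellipse R) : set R[i] :=
  [set z | ComplexField.Normc.normc (z - focus1 E)
           + ComplexField.Normc.normc (z - focus2 E) = major_axis E].

(* L is a line parallel to e^{-i theta} i R that is tangent to E.  As E is
   non-degenerate, a line is tangent iff it meets E in exactly one point. *)
Definition tangent_at_angle (R : realType) (E : ellipse R) (theta : R)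
    (L : set R[i]) : Prop :=
  (exists lam : R, L = line theta lam) /\
  (exists z : R[i], L `&` ellipse_points E = [set z]).

Definition tangent_line (R : realType) (E : ellipse R) (L : set R[i]) : Prop :=
  exists theta : R, tangent_at_angle E theta L.

Definition point_line (R : realType) (theta : R) (p : R[i]) (L : set R[i]) :
    Prop :=
  (exists lam : R, L = line theta lam) /\ L p.

Definition kippenhahn_contains (R : realType) (n : nat) (A : 'M[R[i]]_n)
    (E : ellipse R) : Prop :=
  forall L : set R[i], tangent_line E L ->
    exists theta : R, exists j : 'I_n,
      0 <= theta /\ theta < 2 * pi /\ L = ell A theta j.

(* C(A) is the union of the ellipses Es and the points ps.  Multisets of lines
   are compared through their multiplicity functions: booleans are summed as
   natural numbers. *)
Definition kippenhahn_is_union (R : realType) (n : nat) (A : 'M[R[i]]_n)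
    (Es : seq (ellipse R)) (ps : seq R[i]) : Prop :=
  forall theta : R, 0 <= theta -> theta < 2 * pi ->
  forall L : set R[i],
    (\sum_(j < n) `[< ell A theta j = L >]
     = \sum_(E <- Es) `[< tangent_at_angle E theta L >]
       + \sum_(p <- ps) `[< point_line theta p L >])%N.

Definition contains_two_nonconcentric_ellipses (R : realType) (n : nat)
    (A : 'M[R[i]]_n) : Prop :=
  exists E1 E2 : ellipse R,
    center E1 <> center E2 /\
    kippenhahn_contains A E1 /\ kippenhahn_contains A E2.

(* Main.v *)
(* For a reciprocal matrix the squared moduli of the off-diagonal entries of
   Re(e^{i theta} A) are x_j = xi_j + cos^2 theta, so its characteristic
   polynomial is X (X^4 - S X^2 + P) with S = sum x_j and
   P = x_1 x_3 + x_1 x_4 + x_2 x_4.  A line Re(e^{i theta} z) = lam is tangent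
   to an ellipse iff the product of the signed distances from the two foci is a
   quarter of the squared minor axis, i.e. iff (lam - u)^2 = w, where u comes
   from the center and w = v^2 + m^2/4 from half the focal vector and the minor
   axis m.  If the center is nonzero, then u + sqrt w and u - sqrt w have
   distinct nonzero squares for generic theta; since the polynomial is odd,
   this forces S = 2 (u^2 + w) and P = (u^2 - w)^2.  Hence an ellipse with
   nonzero center always comes with its reflection in 0, and of two
   non-concentric ellipses one has a nonzero center.  Comparing coefficients of
   these two trigonometric identities determines the foci, and leaves
   e^2 = - xi_2 xi_3 for the deviation e of xi_1 from its required value, so
   that both sides vanish. *)

Require Import Defs.
From HB Require Import structures.
From mathcomp Require Import all_boot all_order all_algebra.
From mathcomp Require Import complex.
From mathcomp Require Import all_classical all_reals.
From mathcomp Require Import trigo ring lra zify.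

Import Order.TTheory GRing.Theory Num.Theory.

Local Open Scope ring_scope.
Local Open Scope complex_scope.

Local Notation normc := ComplexField.Normc.normc.

(** * Angles, lines, and tangency to an ellipse *)

Lemma exists_angle {R : realType} (c s : R) : c ^+ 2 + s ^+ 2 = 1 ->
  exists theta, [/\ 0 <= theta, theta < 2 * pi, cos theta = c & sin theta = s].
Proof.
move=> cs1; have c1 : -1 <= c <= 1 by apply/andP; split; nra.
have [a0 api] := (acos_ge0 c1, acos_lepi c1); have pi0 := pi_gt0 R.
have cK : cos (acos c) = c by rewrite acosK // in_itv.
have sK : sin (acos c) = `|s|.
  by rewrite sin_acos // -sqrtr_sqr; congr Num.sqrt; rewrite -cs1; ring.
have [s0|s0] := leP 0 s.
  exists (acos c); split=> //; first lra.
  by rewrite sK ger0_norm.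
(* For [s < 0] the angle is reflected. It stays below [2 * pi] because [acos c] is nonzero, its sine
   being [|s|]. *)
exists (2 * pi - acos c).
have aN0 : acos c != 0.
  apply/eqP => a0'; move: sK; rewrite a0' sin0 => /esym/eqP.
  by rewrite normr_eq0; lra.
have a_gt0 : 0 < acos c by rewrite lt_def aN0.
have e : 2 * pi - acos c = - acos c + pi *+ 2 by rewrite -mulr_natl; ring.
split; [lra|lra| |].
  by rewrite e cosD2pi cosN.
by rewrite e sinD2pi sinN sK ltr0_norm ?opprK.
Qed.

Definition proj {R : realType} (theta : R) (z : R[i]) : R :=
  complex.Re (expi theta * z).

Lemma projE {R : realType} (theta : R) z :
  proj theta z = cos theta * complex.Re z - sin theta * complex.Im z.
Proof. by case: z. Qed.

Lemma linePt {R : realType} (theta lam t : R) :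
  expi (- theta) * (lam +i* t) =
  (cos theta * lam + sin theta * t) +i* (cos theta * t - sin theta * lam).
Proof.
by rewrite /expi cosN sinN; simpc.
Qed.

Lemma lineP {R : realType} (theta lam : R) z :
  line theta lam z <-> proj theta z = lam.
Proof.
have cs := cos2Dsin2 theta; rewrite projE; split=> [[t _ <-]|zl].
  by rewrite linePt -[RHS]mul1r -cs /=; ring.
exists (cos theta * complex.Im z + sin theta * complex.Re z) => //.
rewrite linePt -zl; case: z {zl} => a b /=.
by congr Complex; [rewrite -[RHS]mul1r -cs | rewrite -[RHS]mul1r -cs]; ring.
Qed.

Lemma line_inj {R : realType} (theta lam mu : R) :
  line theta lam = line theta mu -> lam = mu.
Proof.
move=> e; have : line theta lam (expi (- theta) * (lam +i* 0)) by exists 0.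
by move=> /[dup] /lineP h; rewrite e => /lineP <-.
Qed.

(** One line may be listed under two opposite angles. The characteristic polynomial depends on the
    angle only through [cos theta ^+ 2] and is odd, so this much control suffices. *)
Lemma line_eq {R : realType} (theta lam theta' lam' : R) :
  line theta lam = line theta' lam' ->
  cos theta' ^+ 2 = cos theta ^+ 2 /\ (lam' = lam \/ lam' = - lam).
Proof.
move=> e; have on t : proj theta' (expi (- theta) * (lam +i* t)) = lam'.
  by apply/lineP; rewrite -e; exists t.
have [h0 h1] := (on 0, on 1); move: h0 h1; rewrite !linePt !projE /=.
have := cos2Dsin2 theta; have := cos2Dsin2 theta'.
move: (cos theta) (sin theta) (cos theta') (sin theta') => c s c' s' cs' cs h0 h1.
have d : c' * s = s' * c by lra.
(* [k] is the cosine of [theta' - theta]; by [d] the sine vanishes, so [k] is 1 or -1. *)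
pose k := c' * c + s' * s.
have k2 : k ^+ 2 = 1.
  have -> : k ^+ 2 = (c' ^+ 2 + s' ^+ 2) * (c ^+ 2 + s ^+ 2) - (c' * s - s' * c) ^+ 2.
    by rewrite /k; ring.
  by rewrite cs cs' d; ring.
have c'E : c' = c * k.
  have -> : c' = c' * (c ^+ 2 + s ^+ 2) - s * (c' * s - s' * c).
    by rewrite cs d; ring.
  by rewrite /k; ring.
have lE : lam' = k * lam by rewrite -h0 /k; ring.
split; first by rewrite c'E exprMn k2 mulr1.
move/eqP: k2; rewrite sqrf_eq1 => /orP[]/eqP kE; rewrite lE kE; [left|right]; ring.
Qed.

(* For p = (x, y) and d = (v, h), either side amounts to
   |p - d| = a - (p.d)/a and |p + d| = a + (p.d)/a; these right-hand sides are
   nonnegative because |p| <= a. *)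
Lemma sum_dist_eq {R : realType} (x y v h a b2 : R) :
  0 < b2 -> 0 < a -> a ^+ 2 = b2 + v ^+ 2 + h ^+ 2 ->
  (Num.sqrt ((x - v) ^+ 2 + (y - h) ^+ 2)
    + Num.sqrt ((x + v) ^+ 2 + (y + h) ^+ 2) = 2 * a) <->
  (a ^+ 2 * (x ^+ 2 + y ^+ 2) - (x * v + y * h) ^+ 2 = a ^+ 2 * b2).
Proof.
move=> b0 a0 aE; set k := x * v + y * h.
have aN0 : a != 0 by rewrite gt_eqF.
have n1 : 0 <= (x - v) ^+ 2 + (y - h) ^+ 2 by rewrite addr_ge0 ?sqr_ge0.
have n2 : 0 <= (x + v) ^+ 2 + (y + h) ^+ 2 by rewrite addr_ge0 ?sqr_ge0.
split=> [|e].
  move: (sqr_sqrtr n1) (sqr_sqrtr n2).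
  set A := Num.sqrt _; set B := Num.sqrt _ => hA hB AB.
  have Ba : a * B = a ^+ 2 + k.
    have : (A - B) * (A + B) = - (4 * k) by rewrite -subr_sqr hA hB /k; ring.
    have AE : A = 2 * a - B by lra.
    by rewrite AB AE => h1; lra.
  have : (a * B) ^+ 2 = (a ^+ 2 + k) ^+ 2 by rewrite Ba.
  rewrite exprMn hB => h2.
  have {h2} : a ^+ 2 * (x ^+ 2 + y ^+ 2) - k ^+ 2 = a ^+ 2 * (a ^+ 2 - v ^+ 2 - h ^+ 2).
    move: h2; rewrite /k => h2; lra.
  by move=> ->; congr (_ * _); rewrite aE; ring.
have kCS : k ^+ 2 <= (x ^+ 2 + y ^+ 2) * (v ^+ 2 + h ^+ 2).
  rewrite -subr_ge0; have -> : (x ^+ 2 + y ^+ 2) * (v ^+ 2 + h ^+ 2) - k ^+ 2 =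
    (x * h - y * v) ^+ 2 by rewrite /k; ring.
  exact: sqr_ge0.
have pa : x ^+ 2 + y ^+ 2 <= a ^+ 2.
  rewrite -(ler_pM2r b0) -e.
  have -> : b2 = a ^+ 2 - (v ^+ 2 + h ^+ 2) by rewrite aE; ring.
  lra.
have ka : `|k| <= a ^+ 2.
  rewrite -ler_sqr ?nnegrE ?normr_ge0 ?sqr_ge0 //.
  rewrite real_normK ?num_real //; apply: (le_trans kCS).
  rewrite [X in _ <= X]expr2; apply: ler_pM => //.
  - by rewrite addr_ge0 ?sqr_ge0.
  - by rewrite addr_ge0 ?sqr_ge0.
  - by rewrite aE; lra.
have [k1 k2] : - a ^+ 2 <= k /\ k <= a ^+ 2 by move: ka; rewrite ler_norml => /andP.
have sq r : 0 <= a ^+ 2 + r -> Num.sqrt (((a ^+ 2 + r) / a) ^+ 2) = a + r / a.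
  move=> r0; rewrite sqrtr_sqr ger0_norm; first by field.
  exact: divr_ge0 r0 (ltW a0).
have -> : (x - v) ^+ 2 + (y - h) ^+ 2 = ((a ^+ 2 + - k) / a) ^+ 2.
  apply: (mulfI (_ : a ^+ 2 != 0)); first by rewrite sqrf_eq0.
  rewrite exprMn exprVn mulrCA divff ?sqrf_eq0 // mulr1.
  have : a ^+ 2 * (b2 + v ^+ 2 + h ^+ 2) = a ^+ 2 * a ^+ 2 by rewrite aE.
  move: e; rewrite /k => e e2; lra.
have -> : (x + v) ^+ 2 + (y + h) ^+ 2 = ((a ^+ 2 + k) / a) ^+ 2.
  apply: (mulfI (_ : a ^+ 2 != 0)); first by rewrite sqrf_eq0.
  rewrite exprMn exprVn mulrCA divff ?sqrf_eq0 // mulr1.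
  have : a ^+ 2 * (b2 + v ^+ 2 + h ^+ 2) = a ^+ 2 * a ^+ 2 by rewrite aE.
  move: e; rewrite /k => e e2; lra.
rewrite !sq; [by field|lra|lra].
Qed.

Lemma quadratic_unique_root {R : realType} (a b c : R) : 0 < a ->
  (exists t, forall s, a * s ^+ 2 - 2 * b * s + c = 0 <-> s = t) <->
  b ^+ 2 = a * c.
Proof.
move=> a0; have aN0 : a != 0 by rewrite gt_eqF.
split=> [[t tP]|bac].
  have := (tP t).2 erefl => ht.
  (* The reflection of a root in the axis [b / a] is again a root, so uniqueness makes it equal to
     [t]. *)
  have : 2 * b / a - t = t.
    by apply/tP; rewrite -[RHS]ht; field.
  move=> /(congr1 ( *%R a)); rewrite mulrBr mulrCA divff // mulr1 => e.
  have bE : b = a * t by lra.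
  have -> : c = a * t ^+ 2 by move: ht; rewrite bE; lra.
  by rewrite bE; ring.
exists (b / a) => s; have cE : c = b ^+ 2 / a by rewrite bac; field.
have -> : a * s ^+ 2 - 2 * b * s + c = a * (s - b / a) ^+ 2 by rewrite cE; field.
split=> [/eqP|->]; last by rewrite subrr; ring.
by rewrite mulf_eq0 (negbTE aN0) /= sqrf_eq0 subr_eq0 => /eqP.
Qed.

Lemma normc_expiM {R : realType} (theta : R) z : normc (expi theta * z) = normc z.
Proof.
rewrite ComplexField.Normc.normcM /expi /ComplexField.Normc.normc.
by rewrite cos2Dsin2 sqrtr1 mul1r.
Qed.

Lemma expiK {R : realType} (theta : R) : expi theta * expi (- theta) = 1.
Proof.
rewrite /expi cosN sinN; simpc.
by congr Complex; [have := cos2Dsin2 theta; lra | ring].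
Qed.

(** Rotation by [theta] makes the line vertical. Then [(x, y)] is the position relative to the
    center, [(v, h)] half the focal vector, and [a2], [b2] are the squared semi-axes. *)
Lemma ellipse_pointsP {R : realType} (E : ellipse R) (theta lam t : R) :
  let p1 := proj theta (focus1 E) in let p2 := proj theta (focus2 E) in
  let q1 := complex.Im (expi theta * focus1 E) in
  let q2 := complex.Im (expi theta * focus2 E) in
  let x := lam - (p1 + p2) / 2 in
  let v := (p1 - p2) / 2 in let h := (q1 - q2) / 2 in
  let y := t - (q1 + q2) / 2 in
  let b2 := minor_axis E ^+ 2 / 4 in
  let a2 := b2 + v ^+ 2 + h ^+ 2 in
  ellipse_points E (expi (- theta) * (lam +i* t)) <->
  a2 * (x ^+ 2 + y ^+ 2) - (x * v + y * h) ^+ 2 = a2 * b2.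
Proof.
move=> p1 p2 q1 q2 x v h y b2 a2.
have m0 := minor_axis_gt0 E.
have b0 : 0 < b2 by rewrite divr_gt0 ?exprn_gt0.
have a20 : 0 < a2 by rewrite ltr_pwDl ?sqr_ge0 // ltr_pwDl ?sqr_ge0.
have sa0 : 0 < Num.sqrt a2 by rewrite sqrtr_gt0.
have saE : Num.sqrt a2 ^+ 2 = a2 by rewrite sqr_sqrtr // ltW.
have n f : normc (expi (- theta) * (lam +i* t) - f) =
   Num.sqrt ((lam - proj theta f) ^+ 2 + (t - complex.Im (expi theta * f)) ^+ 2).
  rewrite -(normc_expiM theta) mulrBr mulrA expiK mul1r /proj.
  by case: (expi theta * f).
have Mx : major_axis E = 2 * Num.sqrt a2.
  rewrite /major_axis -(normc_expiM theta) mulrBr.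
  have -> : 2 * Num.sqrt a2 = Num.sqrt (2 ^+ 2 * a2).
    by rewrite sqrtrM ?sqr_ge0 // sqrtr_sqr ger0_norm.
  congr Num.sqrt; rewrite /a2 /b2 /v /h /p1 /p2 /q1 /q2 /proj.
  case: (expi theta * focus1 E) => ? ?; case: (expi theta * focus2 E) => ? ? /=.
  rewrite sqr_sqrtr ?addr_ge0 ?sqr_ge0 //; by field.
have -> : ellipse_points E (expi (- theta) * (lam +i* t)) <->
  normc (expi (- theta) * (lam +i* t) - focus1 E)
  + normc (expi (- theta) * (lam +i* t) - focus2 E) = major_axis E by [].
rewrite !n Mx -/p1 -/p2 -/q1 -/q2 -[X in X * _ - _]saE -[X in X * b2]saE.
rewrite -(sum_dist_eq x y v h _ b2 b0 sa0 saE).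
have -> : lam - p1 = x - v by rewrite /x /v; field.
have -> : lam - p2 = x + v by rewrite /x /v; field.
have -> : t - q1 = y - h by rewrite /y /h; field.
have -> // : t - q2 = y + h by rewrite /y /h; field.
Qed.

(** On the vertical line the ellipse equation is quadratic in [y] with leading coefficient
    [b2 + v ^+ 2 > 0]. Its reduced discriminant is [a2 * b2 * (b2 + v ^+ 2 - x ^+ 2)], so tangency
    means [x ^+ 2 - v ^+ 2 = b2]. *)
Lemma tangentP {R : realType} (E : ellipse R) (theta lam : R) :
  tangent_at_angle E theta (line theta lam) <->
  (lam - proj theta (focus1 E)) * (lam - proj theta (focus2 E))
  = minor_axis E ^+ 2 / 4.
Proof.
have EP := ellipse_pointsP E theta lam.
set p1 := proj theta _ in EP *; set p2 := proj theta _ in EP *.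
set q1 := complex.Im (expi theta * focus1 E) in EP.
set q2 := complex.Im (expi theta * focus2 E) in EP.
move: EP => /=.
set x := lam - _; set v := (p1 - p2) / 2; set h := (q1 - q2) / 2.
set b2 := minor_axis E ^+ 2 / 4; set a2 := b2 + _ + _ => EP.
have b0 : 0 < b2 by rewrite divr_gt0 ?exprn_gt0 ?minor_axis_gt0.
have w0 : 0 < b2 + v ^+ 2 by rewrite ltr_pwDl ?sqr_ge0.
have a0 : 0 < a2 by rewrite ltr_pwDl ?sqr_ge0.
have -> : (lam - p1) * (lam - p2) = x ^+ 2 - v ^+ 2 by rewrite /x /v; field.
transitivity (exists t, forall s, (b2 + v ^+ 2) * s ^+ 2 - 2 * (x * v * h) * s
    + (a2 * x ^+ 2 - x ^+ 2 * v ^+ 2 - a2 * b2) = 0 <-> s = t).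
  (* [q] is the height of the center: the quadratic is in the height above the center, while points
     of the line carry the absolute height. *)
  pose q := (q1 + q2) / 2.
  have on s : ellipse_points E (expi (- theta) * (lam +i* s)) <->
     (b2 + v ^+ 2) * (s - q) ^+ 2 - 2 * (x * v * h) * (s - q)
      + (a2 * x ^+ 2 - x ^+ 2 * v ^+ 2 - a2 * b2) = 0.
    rewrite EP -/q; have -> : b2 + v ^+ 2 = a2 - h ^+ 2 by rewrite /a2; ring.
    by split=> [/eqP|/eqP]; rewrite -subr_eq0 => /eqP e; apply/eqP;
      rewrite -?[_ == _ * _]subr_eq0; apply/eqP; rewrite -e; ring.
  have inj s s' : expi (- theta) * (lam +i* s) = expi (- theta) * (lam +i* s') -> s = s'.
    by move=> /(congr1 (fun z => expi theta * z)); rewrite !mulrA !expiK !mul1r => -[].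
  split=> [[_ [z zE]]|[t tP]].
    have : (line theta lam `&` ellipse_points E)%classic z by rewrite zE.
    case=> -[t _ tz] zE'; exists (t - q) => s; split=> [sP|->].
      have : (line theta lam `&` ellipse_points E)%classic (expi (- theta) * (lam +i* (s + q))).
        by split; [exists (s + q) | apply/on; rewrite addrK].
      by rewrite zE /= -tz => /inj <-; rewrite addrK.
    by apply/on; rewrite tz.
  split; first by exists lam.
  exists (expi (- theta) * (lam +i* (t + q))); apply/seteqP; split=> z /=.
    by case=> -[s _ <-] /on /tP <-; rewrite subrK.
  by move=> ->; split; [exists (t + q) | apply/on; rewrite addrK; apply/tP].
rewrite quadratic_unique_root //.
split=> e.
  have : a2 * b2 * (x ^+ 2 - v ^+ 2) = a2 * b2 * b2.
    by move/eqP: e; rewrite -subr_eq0 => /eqP e; apply/eqP; rewrite -subr_eq0;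
      apply/eqP; rewrite -[RHS]oppr0 -[in RHS]e /a2; ring.
  by apply: mulfI; rewrite mulf_neq0 ?gt_eqF.
have xE : x ^+ 2 = b2 + v ^+ 2 by rewrite -e; ring.
have -> : (x * v * h) ^+ 2 = x ^+ 2 * v ^+ 2 * h ^+ 2 by clearbody x v h; ring.
by rewrite xE /a2; clearbody v h b2; ring.
Qed.

(** * The characteristic polynomial and its roots *)

(** Indices are natural numbers, so that trailing blocks are obtained by shifting them. *)
Definition tridiag {K : comNzRingType} (x b c : nat -> K) (i j : nat) : K :=
  if i == j then x i else if j == i.+1 then b i else if i == j.+1 then c j else 0.

(** The continuant recurrence: expansion along the first row leaves two terms, and the second minor
    is expanded along its first column. *)
Lemma det_tridiag_rec {K : comNzRingType} (x b c : nat -> K) (n k : nat) :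
  \det (\matrix_(i < n.+2, j < n.+2) tridiag x b c (k + i) (k + j)) =
  x k * \det (\matrix_(i < n.+1, j < n.+1) tridiag x b c (k.+1 + i) (k.+1 + j))
  - b k * c k * \det (\matrix_(i < n, j < n) tridiag x b c (k.+2 + i) (k.+2 + j)).
Proof.
set T := tridiag x b c.
have T0 i j : (i.+1 < j)%N -> T i j = 0 /\ T j i = 0.
  move=> ij; rewrite /T /tridiag !ifF //; apply/eqP; lia.
rewrite (expand_det_row _ ord0) !big_ord_recl big1 ?addr0; last first.
  move=> i _; rewrite mxE /= (T0 _ _ _).1 ?mul0r //= /bump /=; lia.
congr (_ + _).
  rewrite mxE /= addn0 {1}/T /tridiag eqxx; congr (_ * _).
  rewrite /cofactor expr0 mul1r; congr (\det _).
  by apply/matrixP=> i j; rewrite !mxE /= /bump /=; congr (T _ _); lia.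
rewrite mxE /= /bump /= addn0 addn1 {1}/T {1}/tridiag ifF ?eqxx; last by apply/eqP; lia.
rewrite -mulrA -mulrN; congr (_ * _).
rewrite /cofactor expr1 mulN1r; congr (- _).
rewrite (expand_det_col _ ord0) big_ord_recl big1 ?addr0; last first.
  move=> i _; rewrite !mxE /= (T0 _ _ _).2 ?mul0r //= /bump /=; lia.
rewrite !mxE /= /bump /= !addn0 addn1 {1}/T {1}/tridiag ifF; last by apply/eqP; lia.
rewrite ifF ?eqxx; last by apply/eqP; lia.
congr (_ * _); rewrite /cofactor expr0 mul1r; congr (\det _).
by apply/matrixP=> i j; rewrite !mxE /= /bump /=; congr (T _ _); lia.
Qed.

Lemma det_tridiag5 {K : comNzRingType} (z : K) (b c : nat -> K) :
  let d i := b i * c i in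
  \det (\matrix_(i < 5, j < 5) tridiag (fun=> z) b c i j) =
  z ^+ 5 - (d 0%N + d 1%N + d 2%N + d 3%N) * z ^+ 3
  + (d 0%N * d 2%N + d 0%N * d 3%N + d 1%N * d 3%N) * z.
Proof.
rewrite /= (det_tridiag_rec (fun=> z) b c 3 0) !det_tridiag_rec.
rewrite !det_mx00 !det_mx11 !mxE /tridiag eqxx.
ring.
Qed.

Lemma normc_sqr {R : realType} (z : R[i]) :
  normc z ^+ 2 = complex.Re z ^+ 2 + complex.Im z ^+ 2.
Proof. by case: z => a b /=; rewrite sqr_sqrtr ?addr_ge0 ?sqr_ge0. Qed.

Lemma re_mxE {R : realType} (n : nat) (H : 'M[R[i]]_n) i j :
  re_mx H i j = 2^-1 * (H i j + (H j i)^*%C).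
Proof. by rewrite !mxE. Qed.

(** The product is [|a + b|^2 / 4] with [a] the rotated entry and [b] the conjugate of the rotated
    opposite entry. As the original entries multiply to 1, the cross term is
    [2 * cos (2 * theta)]. *)
Lemma re_mx_reciprocal {R : realType} (n : nat) (A : 'M[R[i]]_n) theta i j :
  A i j * A j i = 1 ->
  re_mx (expi theta *: A) i j * re_mx (expi theta *: A) j i =
  (4^-1 * (normc (A i j) - normc (A j i)) ^+ 2 + cos theta ^+ 2)%:C.
Proof.
move=> aa'; rewrite !re_mxE !mxE.
have nn : normc (A i j) * normc (A j i) = 1.
  by rewrite -ComplexField.Normc.normcM aa' ComplexField.Normc.normc1.
have -> : (normc (A i j) - normc (A j i)) ^+ 2 =
    normc (A i j) ^+ 2 + normc (A j i) ^+ 2 - 2.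
  by rewrite sqrrB nn; ring.
rewrite !normc_sqr; move: aa' {nn}; case: (A i j) => p q; case: (A j i) => p' q'.
move=> -[e1 e2] /=.
have -> : 2^-1 = (2^-1)%:C :> R[i] by rewrite fmorphV rmorph_nat.
have := cos2Dsin2 theta; rewrite /expi; move: (cos theta) (sin theta) => c s cs.
simpc; congr Complex; last by ring.
(* The last bracket is the real part of [e^{2 i theta}] times the product of the two entries, with
   the double angle expanded; [e1] and [e2] say that this product is 1. *)
transitivity (4^-1 * ((c ^+ 2 + s ^+ 2) * (p ^+ 2 + q ^+ 2 + p' ^+ 2 + q' ^+ 2)
  + 2 * ((2 * c ^+ 2 - (c ^+ 2 + s ^+ 2)) * (p * p' - q * q')
         - 2 * c * s * (p * q' + q * p')))); first by field.
by rewrite e1 e2 cs; field.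
Qed.

Lemma perm_eigenvalues {R : realType} (n : nat) (H : 'M[R[i]]_n) (rs : seq R) :
  char_poly H = map_poly (real_complex R) (\prod_(r <- rs) ('X - r%:P)) ->
  perm_eq (eigenvalues H) rs.
Proof.
move=> pE; rewrite /eigenvalues perm_sort.
case: closed_field_poly_normal => s /= sE.
move: sE; rewrite (eqP (char_poly_monic H)) scale1r pE -(prod_map_poly _ _ xpredT).
move=> /prod_XsubC_eq sE.
have -> : rs = [seq complex.Re z | z <- [seq r%:C | r <- rs]].
  by rewrite -map_comp map_id_in.
by apply: perm_map; rewrite perm_sym.
Qed.

(** [char_coef3] and [char_coef1] are S and P as functions of [t = cos^2 theta]. *)
Definition char_coef3 {R : realType} (A : 'M[R[i]]_5) (t : R) : R :=
  xi A 1 + xi A 2 + xi A 3 + xi A 4 + 4 * t.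

Definition char_coef1 {R : realType} (A : 'M[R[i]]_5) (t : R) : R :=
  (xi A 1 + t) * (xi A 3 + t) + (xi A 1 + t) * (xi A 4 + t)
  + (xi A 2 + t) * (xi A 4 + t).

Lemma char_poly_re_mx {R : realType} (A : 'M[R[i]]_5) (theta : R) :
  reciprocal A ->
  char_poly (re_mx (expi theta *: A)) = map_poly (real_complex R)
    ('X ^+ 5 - (char_coef3 A (cos theta ^+ 2))%:P * 'X ^+ 3
     + (char_coef1 A (cos theta ^+ 2))%:P * 'X).
Proof.
move=> [A0 A1]; set H := re_mx _.
pose b (i : nat) := - (H (inord i) (inord i.+1))%:P.
pose c (i : nat) := - (H (inord i.+1) (inord i))%:P.
have HE : char_poly_mx H = \matrix_(i < 5, j < 5) tridiag (fun=> 'X) b c i j.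
  apply/matrixP=> i j; rewrite !mxE /tridiag /b /c.
  have [<-|ij] := eqVneq i j.
    have Aii : A i i = 0 by apply: A0; lia.
    by rewrite !eqxx mulr1n Aii mulr0 rmorph0 addr0 mulr0 subr0.
  rewrite mulr0n sub0r ifF; last by apply/negbTE.
  case: eqP => [e|ne1].
    by rewrite -[in inord i.+1]e !inord_val !mxE.
  case: eqP => [e|ne2].
    by rewrite -[in inord j.+1]e !inord_val !mxE.
  have Aij : A i j = 0 by apply: A0; apply/eqP; lia.
  have Aji : A j i = 0 by apply: A0; apply/eqP; lia.
  by rewrite Aij Aji mulr0 rmorph0 addr0 mulr0 oppr0.
rewrite /char_poly HE det_tridiag5.
(* The signs from [X - H] cancel in the product; the 0-based pair [i], [i.+1] carries the parameter
   number [i.+1]. *)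
have bc i : (i < 4)%N -> b i * c i = ((xi A i.+1 + cos theta ^+ 2)%:C)%:P.
  move=> i4; rewrite /b /c mulrNN -polyCM /H re_mx_reciprocal //.
  by apply: A1; rewrite !inordK //; lia.
rewrite !bc // [RHS]rmorphD [X in _ = X + _]rmorphB /=.
rewrite [map_poly _ (_ * 'X^3)]rmorphM [map_poly _ (_ * 'X)]rmorphM /=.
rewrite !map_polyXn map_polyX !map_polyC.
rewrite -!(polyCM, polyCD) -!(rmorphM, rmorphD) /=.
by congr (_ - _%:C%:P * _ + _%:C%:P * _); rewrite /char_coef3 /char_coef1; ring.
Qed.

Lemma xi_ge0 {R : realType} (n : nat) (A : 'M[R[i]]_n.+1) (j : nat) : 0 <= xi A j.
Proof. by rewrite mulr_ge0 ?sqr_ge0 // invr_ge0. Qed.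

Lemma perm_eigenvalues_re_mx {R : realType} (A : 'M[R[i]]_5) (theta a b : R) :
  reciprocal A ->
  char_coef3 A (cos theta ^+ 2) = a ^+ 2 + b ^+ 2 ->
  char_coef1 A (cos theta ^+ 2) = a ^+ 2 * b ^+ 2 ->
  perm_eq (eigenvalues (re_mx (expi theta *: A))) [:: 0; a; - a; b; - b].
Proof.
move=> rA c3 c1; apply: perm_eigenvalues; rewrite char_poly_re_mx // c3 c1.
congr map_poly; rewrite !big_cons big_nil !(polyCD, polyCM, polyCN, polyC_exp).
rewrite /= polyC0; ring.
Qed.

(** The squares are the roots of [Z^2 - S Z + P]. They are real and nonnegative, since S, P and the
    discriminant [(x_1 + x_2 - x_3 - x_4)^2 + 4 x_2 x_3] are nonnegative. *)
Lemma char_coef_sqr {R : realType} (A : 'M[R[i]]_5) (t : R) : 0 <= t ->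
  exists a b, char_coef3 A t = a ^+ 2 + b ^+ 2 /\ char_coef1 A t = a ^+ 2 * b ^+ 2.
Proof.
move=> t0; set S := char_coef3 A t; set P := char_coef1 A t.
have x0 j : 0 <= xi A j + t by rewrite addr_ge0 ?xi_ge0.
have S0 : 0 <= S.
  have -> : S = xi A 1 + t + (xi A 2 + t) + (xi A 3 + t) + (xi A 4 + t).
    by rewrite /S /char_coef3; ring.
  by do ![exact: x0 | apply: addr_ge0].
have P0 : 0 <= P by do ![exact: x0 | apply: mulr_ge0 | apply: addr_ge0].
have D0 : 0 <= S ^+ 2 - 4 * P.
  have -> : S ^+ 2 - 4 * P = (xi A 1 + xi A 2 - xi A 3 - xi A 4) ^+ 2
      + 4 * ((xi A 2 + t) * (xi A 3 + t)).
    by rewrite /S /P /char_coef3 /char_coef1; ring.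
  by rewrite addr_ge0 ?sqr_ge0 // mulr_ge0 // mulr_ge0 ?x0.
have DS : Num.sqrt (S ^+ 2 - 4 * P) <= S.
  by rewrite -[leRHS]ger0_norm // -sqrtr_sqr; apply: ler_wsqrtr; lra.
have DD := sqr_sqrtr D0; have D0' := sqrtr_ge0 (S ^+ 2 - 4 * P).
move: (Num.sqrt (S ^+ 2 - 4 * P)) DS DD D0' => D DS DD D0'.
exists (Num.sqrt ((S + D) / 2)), (Num.sqrt ((S - D) / 2)).
rewrite !sqr_sqrtr; [|lra|lra].
split; first by field.
have -> : P = (S ^+ 2 - D ^+ 2) / 4 by rewrite DD; field.
by field.
Qed.

Lemma ell_root {R : realType} (A : 'M[R[i]]_5) (theta lam theta' : R) (j : 'I_5) :
  reciprocal A -> line theta lam = ell A theta' j ->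
  let t := cos theta ^+ 2 in
  lam * (lam ^+ 4 - char_coef3 A t * lam ^+ 2 + char_coef1 A t) = 0.
Proof.
move=> rA /line_eq[ct lE] t.
have [a [b [c3 c1]]]   := char_coef_sqr A _ (sqr_ge0 (cos theta)).
have /perm_mem pe : perm_eq (eigenvalues (re_mx (expi theta' *: A))) [:: 0; a; - a; b; - b].
  by apply: perm_eigenvalues_re_mx; rewrite ?ct.
rewrite c3 c1.
have e x : x * (x ^+ 4 - (a ^+ 2 + b ^+ 2) * x ^+ 2 + a ^+ 2 * b ^+ 2) =
  x * (x - a) * (x + a) * (x - b) * (x + b) by ring.
have : nth 0 (eigenvalues (re_mx (expi theta' *: A))) j \in [:: 0; a; - a; b; - b].
  rewrite -pe; set s := eigenvalues _ in pe *; have [js|js] := ltnP j (size s).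
    exact: mem_nth.
  (* Out of range, [nth] returns 0, which is in the list as well. *)
  by rewrite nth_default // pe inE eqxx.
rewrite e !inE; case: lE => -> /or4P[|||/orP[]] /eqP h.
1-5: by rewrite h; ring.
all: by have -> : lam = - (- lam) by [rewrite opprK]; rewrite h; ring.
Qed.

Lemma kippenhahn_contains_root {R : realType} (A : 'M[R[i]]_5) (E : ellipse R)
    (theta lam : R) :
  reciprocal A -> kippenhahn_contains A E ->
  (lam - proj theta (focus1 E)) * (lam - proj theta (focus2 E)) = minor_axis E ^+ 2 / 4 ->
  let t := cos theta ^+ 2 in
  lam * (lam ^+ 4 - char_coef3 A t * lam ^+ 2 + char_coef1 A t) = 0.
Proof.
move=> rA AE /tangentP TE.
have [|theta' [j [_ [_]]]] := AE (line theta lam); first by exists theta.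
exact: ell_root.
Qed.

(** * Necessity: from a contained ellipse to the parameters *)

Lemma horner_ext {R : numDomainType} (p : {poly R}) : (forall x, p.[x] = 0) -> p = 0.
Proof.
move=> p0; apply/eqP/negPn/negP => pN0.
pose rs := [seq k%:R : R | k <- iota 0 (size p)].
have : (size rs < size p)%N.
  apply: max_poly_roots => //; first by apply/allP => x _; apply/rootP.
  by rewrite map_inj_uniq ?iota_uniq //; apply: mulrIn; exact: oner_neq0.
by rewrite size_map size_iota ltnn.
Qed.

(** After division by the nonzero [u + r] and [u - r], their squares are roots of [Z^2 - S Z + P].
    These differ by [4 * u * r != 0], so S and P are their sum and product. *)
Lemma generic_coefs {R : realFieldType} (u r S P : R) :
  let q x := x * (x ^+ 4 - S * x ^+ 2 + P) in
  q (u + r) = 0 -> q (u - r) = 0 -> r != 0 -> u != 0 -> u ^+ 2 != r ^+ 2 ->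
  S = 2 * (u ^+ 2 + r ^+ 2) /\ P = (u ^+ 2 - r ^+ 2) ^+ 2.
Proof.
move=> q qp qm r0 u0; rewrite -subr_eq0 subr_sqr mulf_eq0 negb_or => /andP[um up].
move: qp qm => /eqP; rewrite mulf_eq0 (negbTE up) /= => /eqP qp.
move=> /eqP; rewrite mulf_eq0 (negbTE um) /= => /eqP qm.
have SE : S = 2 * (u ^+ 2 + r ^+ 2).
  apply: (mulfI (_ : 4 * u * r != 0)); first by rewrite !mulf_neq0 // pnatr_eq0.
  apply/eqP; rewrite -subr_eq0 -oppr_eq0; apply/eqP.
  by rewrite -[RHS](subrr 0) -[in X in _ = X - _]qp -[in X in _ = _ - X]qm; ring.
by split=> //; apply/eqP; rewrite -subr_eq0; apply/eqP; rewrite -[RHS]qp SE; ring.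
Qed.

(* In tau = y / x the identities become polynomial ones, which hold off the
   zeros of a nonzero polynomial and hence everywhere. *)
Lemma tangent_identities {R : realType} (c1 c2 d1 d2 m sig k l : R) :
  0 < m -> ~ (c1 = 0 /\ c2 = 0) ->
  (forall x y lam, x ^+ 2 + y ^+ 2 = 1 ->
     (lam - (c1 * x - c2 * y)) ^+ 2 = (d1 * x - d2 * y) ^+ 2 + m ->
     lam * (lam ^+ 4 - (sig + 4 * x ^+ 2) * lam ^+ 2
            + (3 * (x ^+ 2) ^+ 2 + k * x ^+ 2 + l)) = 0) ->
  forall tau, let U := c1 - c2 * tau in let V := d1 - d2 * tau in
    let N := 1 + tau ^+ 2 in
    sig * N + 4 = 2 * (U ^+ 2 + V ^+ 2 + m * N) /\
    3 + k * N + l * N ^+ 2 = (U ^+ 2 - V ^+ 2 - m * N) ^+ 2.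
Proof.
move=> m0 cN0 H.
have gen tau : let U := c1 - c2 * tau in let V := d1 - d2 * tau in
    let N := 1 + tau ^+ 2 in U != 0 -> U ^+ 2 - V ^+ 2 - m * N != 0 ->
    sig * N + 4 = 2 * (U ^+ 2 + V ^+ 2 + m * N) /\
    3 + k * N + l * N ^+ 2 = (U ^+ 2 - V ^+ 2 - m * N) ^+ 2.
  move=> U V N U0 W0.
  have N0 : 0 < N by rewrite ltr_pwDl ?sqr_ge0.
  have nN0 : N != 0 by rewrite gt_eqF.
  pose n := Num.sqrt N; have n0 : n != 0 by rewrite gt_eqF // sqrtr_gt0.
  have nE : n ^+ 2 = N by rewrite sqr_sqrtr // ltW.
  (* The point of the unit circle with slope [tau]; the center then projects to [u = U / n]. *)
  pose x := n^-1; pose y := tau / n; pose u := U / n.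
  have x2 : x ^+ 2 = N^-1 by rewrite /x exprVn nE.
  have xy : x ^+ 2 + y ^+ 2 = 1 by rewrite x2 expr_div_n nE -{1}[N^-1]mul1r -mulrDl divff.
  have uE : c1 * x - c2 * y = u by rewrite /x /y /u /U; field.
  have vE : (d1 * x - d2 * y) ^+ 2 = V ^+ 2 / N.
    by rewrite -nE /x /y /V; field.
  have w0 : 0 < V ^+ 2 / N + m.
    by rewrite ltr_wpDl // divr_ge0 ?sqr_ge0 // ltW.
  pose r := Num.sqrt (V ^+ 2 / N + m).
  have rE : r ^+ 2 = V ^+ 2 / N + m by rewrite sqr_sqrtr // ltW.
  have r0 : r != 0 by rewrite gt_eqF // sqrtr_gt0.
  have u2 : u ^+ 2 = U ^+ 2 / N by rewrite expr_div_n nE.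
  have := H x y (u + r) xy; rewrite uE vE -rE addrAC subrr add0r => /(_ erefl) Hp.
  have := H x y (u - r) xy; rewrite uE vE -rE addrAC subrr add0r sqrrN => /(_ erefl) Hm.
  have u0 : u != 0 by rewrite mulf_neq0 ?invr_neq0.
  have ur : u ^+ 2 != r ^+ 2.
    apply: contraNneq W0 => ur.
    have -> : U ^+ 2 - V ^+ 2 - m * N = N * (u ^+ 2 - r ^+ 2) by rewrite rE u2; field.
    by rewrite ur subrr mulr0.
  have [e1 e2] := generic_coefs _ _ _ _ Hp Hm r0 u0 ur.
  split.
    have -> : sig * N + 4 = N * (sig + 4 * x ^+ 2) by rewrite x2; field.
    by rewrite e1 rE u2; field.
  have -> : 3 + k * N + l * N ^+ 2 = N ^+ 2 * (3 * (x ^+ 2) ^+ 2 + k * x ^+ 2 + l).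
    by rewrite x2; field.
  by rewrite e2 rE u2; field.
pose pU : {poly R} := c1%:P - c2%:P * 'X; pose pV : {poly R} := d1%:P - d2%:P * 'X.
pose pN : {poly R} := 1 + 'X ^+ 2; pose pW := pU ^+ 2 - pV ^+ 2 - m%:P * pN.
have UE x : pU.[x] = c1 - c2 * x by rewrite /pU !hornerE.
have VE x : pV.[x] = d1 - d2 * x by rewrite /pV !hornerE.
have NE x : pN.[x] = 1 + x ^+ 2 by rewrite /pN !hornerE.
have WE x : pW.[x] = (c1 - c2 * x) ^+ 2 - (d1 - d2 * x) ^+ 2 - m * (1 + x ^+ 2).
  by rewrite /pW !hornerE.
have pU0 : pU != 0.
  apply/eqP => p0; apply: cN0; have := UE 0; have := UE 1; rewrite p0 !horner0.
  by move=> h1 h0; split; lra.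
(* At a zero of U the value of W is [- V ^+ 2 - m * N < 0]. If [c2 = 0], the coefficient
   [- d2 ^+ 2 - m] of the square is negative instead. *)
have pW0 : pW != 0.
  apply/eqP => p0.
  have W x : (c1 - c2 * x) ^+ 2 - (d1 - d2 * x) ^+ 2 - m * (1 + x ^+ 2) = 0.
    by rewrite -WE p0 horner0.
  have [c20|c20] := eqVneq c2 0.
    have := W 0; have := W 1; have := W (-1); rewrite c20 => h1 h2 h3.
    have := sqr_ge0 d2; lra.
  have := W (c1 / c2); have -> : c1 - c2 * (c1 / c2) = 0 by field.
  have := sqr_ge0 (d1 - d2 * (c1 / c2)); have := sqr_ge0 (c1 / c2); nra.
have ext (q : {poly R}) :
    (forall x, pU.[x] != 0 -> pW.[x] != 0 -> q.[x] = 0) -> forall x, q.[x] = 0.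
  move=> q0 x; suff -> : q = 0 by rewrite horner0.
  have /eqP : pU * pW * q = 0.
    apply: horner_ext => z; rewrite !hornerM.
    have [->|Uz] := eqVneq pU.[z] 0; first by rewrite !mul0r.
    have [->|Wz] := eqVneq pW.[z] 0; first by rewrite mulr0 mul0r.
    by rewrite q0 // mulr0.
  by rewrite !mulf_eq0 (negbTE pU0) (negbTE pW0) => /eqP.
move=> tau U V N; split; apply/eqP; rewrite -subr_eq0; apply/eqP.
  pose q : {poly R} := sig%:P * pN + 4%:P - 2%:P * (pU ^+ 2 + pV ^+ 2 + m%:P * pN).
  have qE x : q.[x] = sig * (1 + x ^+ 2) + 4 - 2 * ((c1 - c2 * x) ^+ 2
      + (d1 - d2 * x) ^+ 2 + m * (1 + x ^+ 2)).
    by rewrite /q !hornerE.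
  rewrite -qE; apply: ext => x; rewrite UE WE => Ux Wx.
  by rewrite qE (gen x Ux Wx).1 subrr.
pose q : {poly R} := 3%:P + k%:P * pN + l%:P * pN ^+ 2 - pW ^+ 2.
have qE x : q.[x] = 3 + k * (1 + x ^+ 2) + l * (1 + x ^+ 2) ^+ 2
    - ((c1 - c2 * x) ^+ 2 - (d1 - d2 * x) ^+ 2 - m * (1 + x ^+ 2)) ^+ 2.
  by rewrite /q !hornerE.
rewrite -qE; apply: ext => x; rewrite UE WE => Ux Wx.
by rewrite qE (gen x Ux Wx).2 subrr.
Qed.

Lemma parameters_of_identities {R : rcfType} (c1 c2 d1 d2 m x1 x2 x3 x4 : R) :
  0 < m -> 0 <= x1 -> 0 <= x2 -> 0 <= x3 -> 0 <= x4 ->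
  (forall tau, let U := c1 - c2 * tau in let V := d1 - d2 * tau in
     let N := 1 + tau ^+ 2 in
     (x1 + x2 + x3 + x4) * N + 4 = 2 * (U ^+ 2 + V ^+ 2 + m * N) /\
     3 + (2 * x1 + x2 + x3 + 2 * x4) * N + (x1 * x3 + x1 * x4 + x2 * x4) * N ^+ 2
     = (U ^+ 2 - V ^+ 2 - m * N) ^+ 2) ->
  [/\ x2 * x3 = 0, x2 + x3 <> 0,
      x1 = Num.sqrt 3 / 2 * (x2 + x3) + x3 & x4 = Num.sqrt 3 / 2 * (x2 + x3) + x2].
Proof.
move=> m0 x10 x20 x30 x40 H.
set k := 2 * x1 + x2 + x3 + 2 * x4 in H.
set l := x1 * x3 + x1 * x4 + x2 * x4 in H.
have k0 : 0 <= k by rewrite /k; lra.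
pose n0 := c1 ^+ 2 - d1 ^+ 2 - m; pose n1 := 2 * (d1 * d2 - c1 * c2).
pose n2 := c2 ^+ 2 - d2 ^+ 2 - m.
have W tau : 3 + k * (1 + tau ^+ 2) + l * (1 + tau ^+ 2) ^+ 2
    = (n0 + n1 * tau + n2 * tau ^+ 2) ^+ 2.
  by rewrite (H tau).2; congr (_ ^+ 2); rewrite /n0 /n1 /n2; ring.
have L0 : x1 + x2 + x3 + x4 + 4 = 2 * (c1 ^+ 2 + d1 ^+ 2 + m).
  by have := (H 0).1; lra.
have L1 : c1 * c2 + d1 * d2 = 0 by have := (H 1).1; have := (H (-1)).1; lra.
have L2 : x1 + x2 + x3 + x4 = 2 * (c2 ^+ 2 + d2 ^+ 2 + m).
  by have := (H 1).1; have := (H (-1)).1; lra.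
(* Five values determine the five coefficients of a quartic in [tau]. The left side of [W] is even,
   hence [e01] and [e12]; [e3] combines the even coefficients so that [k] and [l] cancel. *)
have [W0 W1 W1' W2 W2'] := And5 (W 0) (W 1) (W (-1)) (W 2) (W (-2)).
have e01 : n0 * n1 = 0 by lra.
have e12 : n1 * n2 = 0 by lra.
have e22 : l = n2 ^+ 2 by lra.
have e02 : k + 2 * l = n1 ^+ 2 + 2 * n0 * n2 by lra.
have e3 : (n0 - n2) ^+ 2 - n1 ^+ 2 = 3 by lra.
have n10 : n1 = 0.
  apply/eqP; apply: contraT => n1N0.
  move/eqP: e01; rewrite mulf_eq0 (negbTE n1N0) orbF => /eqP z0.
  move/eqP: e12; rewrite mulf_eq0 (negbTE n1N0) /= => /eqP z2.
  by have := sqr_ge0 n1; move: e3; rewrite z0 z2; lra.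
have cc : c1 * c2 = 0 by move: n10; rewrite /n1; lra.
have dd : d1 * d2 = 0 by move: n10; rewrite /n1; lra.
have s2 : Num.sqrt 3 ^+ 2 = 3 :> R by rewrite sqr_sqrtr.
have s0 : 0 <= Num.sqrt 3 :> R by exact: sqrtr_ge0.
move: (Num.sqrt 3) s2 s0 => s s2 s0.
have s_lt2 : s < 2 by nra.
have /eqP : (n0 - n2) ^+ 2 = s ^+ 2 by rewrite s2 -e3 n10; ring.
rewrite eqf_sqr => n02.
(* The differences [c1 ^+ 2 - c2 ^+ 2] and [d1 ^+ 2 - d2 ^+ 2] have sum 2, by [L0] and [L2], and
   difference [s] or [- s]. As [s < 2], both are positive, so [c1] and [d1] are nonzero; thus the
   foci are real. *)
have [cd1 cd2] : c2 = 0 /\ d2 = 0.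
  have pos : 0 < c1 ^+ 2 - c2 ^+ 2 /\ 0 < d1 ^+ 2 - d2 ^+ 2.
    by case/orP: n02 => /eqP; rewrite /n0 /n2 => n02; split; lra.
  have [pc pd] := pos; have [c20 d20] := (sqr_ge0 c2, sqr_ge0 d2).
  split; apply/eqP.
    move/eqP: cc; rewrite mulf_eq0 => /orP[/eqP c10|//].
    by move: pc; rewrite c10; lra.
  move/eqP: dd; rewrite mulf_eq0 => /orP[/eqP d10|//].
  by move: pd; rewrite d10; lra.
have n2E : n2 = - m by rewrite /n2 cd1 cd2; ring.
have sigE : x1 + x2 + x3 + x4 = 2 * m by rewrite L2 cd1 cd2; ring.
have lE : l = m ^+ 2 by rewrite e22 n2E; ring.
(* The sign of [n0 - n2] decides that of [k], and [k >= 0] settles it. *)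
have kE : k = 2 * s * m.
  case/orP: n02 => /eqP n02.
    have n0E : n0 = s - m by lra.
    have : k = - (2 * s * m) by move: e02; rewrite n10 n0E n2E lE => e02; lra.
    by move=> kE; have := mulr_ge0 s0 (ltW m0); lra.
  have n0E : n0 = - s - m by lra.
  by move: e02; rewrite n10 n0E n2E lE => e02; lra.
have sumE : x1 + x4 = (1 + s) * (x2 + x3).
  (* [k = s * (x1 + x2 + x3 + x4)] gives the inner equality; the factor [2 + s] turns [2 - s] into 1
     and [s - 1] into [1 + s]. *)
  have : (2 + s) * ((2 - s) * (x1 + x4)) = (2 + s) * ((s - 1) * (x2 + x3)).
    have : k = s * (x1 + x2 + x3 + x4) by rewrite sigE kE; ring.
    by rewrite /k => kE'; congr (_ * _); lra.
  have -> : (2 + s) * ((2 - s) * (x1 + x4)) = (4 - s ^+ 2) * (x1 + x4) by ring.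
  have -> : (2 + s) * ((s - 1) * (x2 + x3)) = (s ^+ 2 + s - 2) * (x2 + x3) by ring.
  by rewrite s2; lra.
have x4E : x4 = (1 + s) * (x2 + x3) - x1 by lra.
have rE : (2 + s) * (x2 + x3) = 2 * m by rewrite -sigE x4E; ring.
(* This is [l = m ^+ 2] after elimination of [x4] and [m]; both summands are nonnegative. *)
have sq : (x1 - s / 2 * (x2 + x3) - x3) ^+ 2 + x2 * x3 = 0.
  have : 4 * l = ((2 + s) * (x2 + x3)) ^+ 2 by rewrite rE lE; ring.
  rewrite /l x4E => h.
  have -> : (x1 - s / 2 * (x2 + x3) - x3) ^+ 2 + x2 * x3 =
     (((2 + s) * (x2 + x3)) ^+ 2 - 4 * (x1 * x3 + x1 * ((1 + s) * (x2 + x3) - x1)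
        + x2 * ((1 + s) * (x2 + x3) - x1))) / 4 by field.
  by rewrite -h; field.
have x230 := mulr_ge0 x20 x30.
have x23 : x2 * x3 = 0 by have := sqr_ge0 (x1 - s / 2 * (x2 + x3) - x3); lra.
have x1E : x1 = s / 2 * (x2 + x3) + x3.
  move/eqP: sq; rewrite x23 addr0 sqrf_eq0 => /eqP; lra.
split=> //; last by rewrite x4E x1E; field.
by move=> r0; move: rE; rewrite r0; lra.
Qed.

Lemma parameters_of_contains {R : realType} (A : 'M[R[i]]_5) (E : ellipse R) :
  reciprocal A -> kippenhahn_contains A E -> center E <> 0 ->
  [/\ xi A 2 * xi A 3 = 0, xi A 2 + xi A 3 <> 0,
      xi A 1 = Num.sqrt 3 / 2 * (xi A 2 + xi A 3) + xi A 3 &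
      xi A 4 = Num.sqrt 3 / 2 * (xi A 2 + xi A 3) + xi A 2].
Proof.
move=> rA AE cE.
pose re z : R := complex.Re z; pose im z : R := complex.Im z.
(* [(c1, c2)] is the center and [(d1, d2)] half the focal vector. *)
pose c1 := (re (focus1 E) + re (focus2 E)) / 2.
pose c2 := (im (focus1 E) + im (focus2 E)) / 2.
pose d1 := (re (focus1 E) - re (focus2 E)) / 2.
pose d2 := (im (focus1 E) - im (focus2 E)) / 2.
have m0 : 0 < minor_axis E ^+ 2 / 4 by rewrite divr_gt0 ?exprn_gt0 ?minor_axis_gt0.
apply: (@parameters_of_identities R c1 c2 d1 d2 (minor_axis E ^+ 2 / 4)) => //;
  try exact: xi_ge0.
apply: tangent_identities => //.
  move=> [c10 c20]; apply: cE; rewrite /center.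
  have -> : focus1 E + focus2 E = 0; last by rewrite mul0r.
  move: c10 c20; rewrite /c1 /c2 /re /im.
  case: (focus1 E) (focus2 E) => [a b] [a' b'] /= h1 h2; simpc.
  by congr Complex; lra.
move=> x y lam xy lamE.
have [theta [_ _ cx sy]] := exists_angle _ _ xy.
have := kippenhahn_contains_root A E theta lam rA AE; rewrite !projE cx sy /=.
have -> : char_coef3 A (x ^+ 2) = xi A 1 + xi A 2 + xi A 3 + xi A 4 + 4 * x ^+ 2 by [].
have -> : char_coef1 A (x ^+ 2) = 3 * (x ^+ 2) ^+ 2
    + (2 * xi A 1 + xi A 2 + xi A 3 + 2 * xi A 4) * x ^+ 2
    + (xi A 1 * xi A 3 + xi A 1 * xi A 4 + xi A 2 * xi A 4).
  by rewrite /char_coef1; ring.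
apply; apply/eqP; rewrite -subr_eq0; apply/eqP.
move/eqP: lamE; rewrite -subr_eq0 => /eqP <-.
by rewrite /c1 /c2 /d1 /d2 /re /im; field.
Qed.

(** * Sufficiency: the multiset of tangent lines *)

Lemma eq_line {R : realType} (theta theta' lam : R) :
  cos theta = cos theta' -> sin theta = sin theta' -> line theta lam = line theta' lam.
Proof. by move=> ec es; rewrite /line /expi !cosN !sinN ec es. Qed.

(** A tangent line has positive multiplicity on the right-hand side, hence on the left, once its
    angle is reduced to [[0, 2 * pi)]. *)
Lemma contains_of_union {R : realType} (n : nat) (A : 'M[R[i]]_n)
    (Es1 Es2 : seq (ellipse R)) (E : ellipse R) (ps : seq R[i]) :
  kippenhahn_is_union A (Es1 ++ E :: Es2) ps -> kippenhahn_contains A E.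
Proof.
move=> U L [theta [[lam LE] TE]].
have [theta' [t0 t1 ec es]] := exists_angle _ _ (cos2Dsin2 theta).
have T : tangent_at_angle E theta' L.
  by split=> //; exists lam; rewrite LE; apply: eq_line.
have := U theta' t0 t1 L; rewrite big_cat big_cons /= (asboolT T) => e.
suff [j jL] : exists j, ell A theta' j = L by exists theta', j.
have [/existsP[j /asboolP jL]|/existsPn N] :=
  boolP [exists j : 'I_n, `[< ell A theta' j = L >]]; first by exists j.
by move: e; rewrite big1 => [|j _]; [lia | rewrite (negbTE (N j))].
Qed.

Lemma count_mem_sum_nth {T : eqType} (x0 x : T) (s : seq T) (n : nat) : size s = n ->
  (\sum_(j < n) (nth x0 s j == x) = count_mem x s)%N.
Proof.
move=> <-; rewrite -sum1_count [RHS]big_mkcond (big_nth x0) big_mkord.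
by apply: eq_bigr => j _ /=; case: eqP.
Qed.

Lemma count_ell {R : realType} (n : nat) (A : 'M[R[i]]_n) (theta lam : R) :
  size (eigenvalues (re_mx (expi theta *: A))) = n ->
  (\sum_(j < n) `[< ell A theta j = line theta lam >]
   = count_mem lam (eigenvalues (re_mx (expi theta *: A))))%N.
Proof.
move=> /(count_mem_sum_nth 0 lam) <-; apply: eq_bigr => j _; congr nat_of_bool.
by apply/asboolP/eqP => [/line_inj|<-].
Qed.

(** [tangentP] after completing the square around the projection [u] of the center. *)
Lemma tangent_at_angle_sqrt {R : realType} (E : ellipse R) (theta lam u r : R) :
  let p1 := proj theta (focus1 E) in let p2 := proj theta (focus2 E) in
  p1 + p2 = 2 * u -> ((p1 - p2) / 2) ^+ 2 + minor_axis E ^+ 2 / 4 = r ^+ 2 ->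
  `[< tangent_at_angle E theta (line theta lam) >] = (u + r == lam) || (u - r == lam).
Proof.
move=> p1 p2 uE rE.
have -> : (u + r == lam) || (u - r == lam) = ((lam - u) ^+ 2 == r ^+ 2).
  rewrite eqf_sqr; congr orb; apply/eqP/eqP; lra.
rewrite -rE; apply/asboolP/eqP => [/tangentP e|e].
  have -> : u = (p1 + p2) / 2 by rewrite uE; field.
  by rewrite -e -/p1 -/p2; field.
apply/tangentP; rewrite -/p1 -/p2.
have {}uE : u = (p1 + p2) / 2 by rewrite uE; field.
apply: (addrI (((p1 - p2) / 2) ^+ 2)); rewrite -e uE; by field.
Qed.

Lemma union_of_parameters {R : realType} (A : 'M[R[i]]_5) (E1 E2 : ellipse R) :
  reciprocal A ->
  xi A 2 * xi A 3 = 0 ->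
  xi A 1 = Num.sqrt 3 / 2 * (xi A 2 + xi A 3) + xi A 3 ->
  xi A 4 = Num.sqrt 3 / 2 * (xi A 2 + xi A 3) + xi A 2 ->
  focus1 E1 = (Num.sqrt 3)%:C -> focus2 E1 = -1 ->
  focus1 E2 = (- Num.sqrt 3)%:C -> focus2 E2 = 1 ->
  minor_axis E1 = (1 + Num.sqrt 3) * Num.sqrt (xi A 2 + xi A 3) ->
  minor_axis E2 = (1 + Num.sqrt 3) * Num.sqrt (xi A 2 + xi A 3) ->
  kippenhahn_is_union A [:: E1; E2] [:: 0].
Proof.
move=> rA x23 x1E x4E f1 f1' f2 f2' m1 m2 theta _ _ L.
(* A line of another direction has multiplicity zero on both sides. *)
have [[lam ->]|noL] := pselect (exists lam, L = line theta lam); last first.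
  rewrite !big_cons !big_nil big1 => [|j _]; last first.
    by case: asboolP => // eL; case: noL; eexists; apply/esym; exact: eL.
  have T E : `[< tangent_at_angle E theta L >] = false by apply/asboolP => -[].
  by rewrite !T asboolF // => -[].
set s := Num.sqrt 3 in x1E x4E f1 f2 m1 m2.
have s2 : s ^+ 2 = 3 :> R by rewrite sqr_sqrtr.
have r0 : 0 <= xi A 2 + xi A 3 by rewrite addr_ge0 ?xi_ge0.
have mE : ((1 + s) * Num.sqrt (xi A 2 + xi A 3)) ^+ 2 / 4
    = (2 + s) / 2 * (xi A 2 + xi A 3).
  rewrite exprMn sqr_sqrtr //.
  have -> : (1 + s) ^+ 2 = 2 * (2 + s) by rewrite sqrrD s2; ring.
  by field.
(* [u] is the projected center of [E1], and [w] the square of half the projected focal vector plus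
   [m^2 / 4]. For [E2], [u] changes sign and [w] is the same. *)
pose t := cos theta; pose u := (s - 1) / 2 * t.
pose w := ((s + 1) / 2 * t) ^+ 2 + (2 + s) / 2 * (xi A 2 + xi A 3).
have m10 := minor_axis_gt0 E1.
have w0 : 0 < w.
  by rewrite /w -mE -m1 ltr_wpDl ?sqr_ge0 // divr_gt0 ?exprn_gt0.
have rw : Num.sqrt w ^+ 2 = w by rewrite sqr_sqrtr // ltW.
have rw0 : 0 < Num.sqrt w by rewrite sqrtr_gt0.
move: (Num.sqrt w) rw rw0 => r rw rw0.
have pe : perm_eq (eigenvalues (re_mx (expi theta *: A)))
    [:: 0; u + r; - (u + r); u - r; - (u - r)].
  have w2 : 2 * (u ^+ 2 + w) = 4 * t ^+ 2 + (2 + s) * (xi A 2 + xi A 3).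
    have -> : 2 * (u ^+ 2 + w) = (s ^+ 2 + 1) * t ^+ 2 + (2 + s) * (xi A 2 + xi A 3).
      by rewrite /w /u; field.
    by rewrite s2; ring.
  have uw : u ^+ 2 - w = - (s * t ^+ 2 + (2 + s) / 2 * (xi A 2 + xi A 3)).
    by rewrite /w /u; field.
  apply: perm_eigenvalues_re_mx => //.
    have -> : (u + r) ^+ 2 + (u - r) ^+ 2 = 2 * (u ^+ 2 + w) by rewrite -rw; ring.
    by rewrite w2 /char_coef3 x1E x4E -/t; field.
  have -> : (u + r) ^+ 2 * (u - r) ^+ 2 = (u ^+ 2 - w) ^+ 2 by rewrite -rw; ring.
  rewrite uw /char_coef1 x1E x4E -/t; apply/eqP; rewrite -subr_eq0; apply/eqP.
  (* The difference is written through the two quantities known to vanish, [3 - s ^+ 2] and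
     [xi A 2 * xi A 3]. *)
  transitivity ((3 - s ^+ 2) * (t ^+ 2 * (t ^+ 2 + (xi A 2 + xi A 3)))
      - xi A 2 * xi A 3); first by field.
  by rewrite s2 x23 subrr mul0r subr0.
rewrite count_ell; last by rewrite (perm_size pe).
rewrite (permP pe) !big_cons !big_nil /=.
have T1 : `[< tangent_at_angle E1 theta (line theta lam) >]
    = (u + r == lam) || (u - r == lam).
  apply: tangent_at_angle_sqrt; rewrite f1 f1' !projE /= -/t ?m1 ?mE ?rw.
    by rewrite /u; field.
  by rewrite /w; field.
have T2 : `[< tangent_at_angle E2 theta (line theta lam) >]
    = (- u + r == lam) || (- u - r == lam).
  apply: tangent_at_angle_sqrt; rewrite f2 f2' !projE /= -/t ?m2 ?mE ?rw.
    by rewrite /u; field.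
  by rewrite /w; field.
have T0 : `[< point_line theta 0 (line theta lam) >] = (0 == lam).
  apply/asboolP/eqP => [[_ /lineP]|<-]; first by rewrite projE /= !mulr0 subrr.
  by split; [exists 0 | apply/lineP; rewrite projE /= !mulr0 subrr].
(* The two parallel tangents of one ellipse are distinct because [r > 0], so the disjunction counts
   as a sum. *)
have orE (a b : R) : a != b -> ((a == lam) || (b == lam) = (a == lam) + (b == lam) :> nat)%N.
  by move=> ab; case: (a =P lam) => // <-; rewrite eq_sym (negbTE ab).
have n1 : u + r != u - r by apply/eqP => e; clearbody u; lra.
have n2 : - u + r != - u - r by apply/eqP => e; clearbody u; lra.
rewrite T1 T2 T0 !orE //.
have -> : - (u + r) = - u - r by ring.
have -> : - (u - r) = - u + r by ring.
move: (0 == lam) (u + r == lam) (- u - r == lam) (u - r == lam) (- u + r == lam).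
by clear=> b0 b1 b2 b3 b4; lia.
Qed.

Theorem theorem6 (R : realType) (A : 'M[R[i]]_5) (hA : reciprocal A) :
  (contains_two_nonconcentric_ellipses A <->
     (xi A 2 * xi A 3 = 0 /\
      xi A 2 + xi A 3 <> 0 /\
      xi A 1 = Num.sqrt 3 / 2 * (xi A 2 + xi A 3) + xi A 3 /\
      xi A 4 = Num.sqrt 3 / 2 * (xi A 2 + xi A 3) + xi A 2)) /\
  (contains_two_nonconcentric_ellipses A ->
     exists E1 E2 : ellipse R,
       focus1 E1 = (Num.sqrt 3)%:C /\ focus2 E1 = -1 /\
       focus1 E2 = (- Num.sqrt 3)%:C /\ focus2 E2 = 1 /\
       minor_axis E1 = (1 + Num.sqrt 3) * Num.sqrt (xi A 2 + xi A 3) /\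
       minor_axis E2 = (1 + Num.sqrt 3) * Num.sqrt (xi A 2 + xi A 3) /\
       kippenhahn_is_union A [:: E1; E2] [:: 0]).
Proof.
pose conditions := [/\ xi A 2 * xi A 3 = 0, xi A 2 + xi A 3 <> 0,
  xi A 1 = Num.sqrt 3 / 2 * (xi A 2 + xi A 3) + xi A 3 &
  xi A 4 = Num.sqrt 3 / 2 * (xi A 2 + xi A 3) + xi A 2].
have necessary : contains_two_nonconcentric_ellipses A -> conditions.
  move=> [E1 [E2 [c12 [AE1 AE2]]]].
  have [c1|/eqP c1] := eqVneq (center E1) 0; last exact: parameters_of_contains AE1 c1.
  by apply: parameters_of_contains AE2 _ => // c2; apply: c12; rewrite c1.
have union : conditions -> exists E1 E2 : ellipse R,
    focus1 E1 = (Num.sqrt 3)%:C /\ focus2 E1 = -1 /\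
    focus1 E2 = (- Num.sqrt 3)%:C /\ focus2 E2 = 1 /\
    minor_axis E1 = (1 + Num.sqrt 3) * Num.sqrt (xi A 2 + xi A 3) /\
    minor_axis E2 = (1 + Num.sqrt 3) * Num.sqrt (xi A 2 + xi A 3) /\
    kippenhahn_is_union A [:: E1; E2] [:: 0].
  move=> [x23 r0 x1 x4].
  have m0 : 0 < (1 + Num.sqrt 3) * Num.sqrt (xi A 2 + xi A 3).
    rewrite mulr_gt0 ?ltr_wpDr ?sqrtr_ge0 // sqrtr_gt0 lt_def addr_ge0 ?xi_ge0 // andbT.
    exact/eqP.
  exists (Ellipse (Num.sqrt 3)%:C (-1) m0), (Ellipse (- Num.sqrt 3)%:C 1 m0).
  by do 6!split=> //; apply: union_of_parameters.
split; last by move=> /necessary/union.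
split=> [/necessary[]|[x23 [r0 [x1 x4]]]]; first by [].
have [|E1 [E2 [f1 [f1' [f2 [f2' [_ [_ U]]]]]]]] := union; first by split.
exists E1, E2; split; last first.
  split; first exact: (contains_of_union _ _ [::] [:: E2] _ _ U).
  exact: (contains_of_union _ _ [:: E1] [::] _ _ U).
(* Equal centers would give [sqrt 3 - 1 = 1 - sqrt 3]. *)
rewrite /center f1 f1' f2 f2' => /(congr1 (fun z => complex.Re (z * 2))).
rewrite !divfK ?pnatr_eq0 //= => e.
have : Num.sqrt 3 ^+ 2 = 3 :> R by rewrite sqr_sqrtr.
have -> : Num.sqrt 3 = 1 :> R by lra.
by rewrite expr1n; lra.
Qed.
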